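(* Let $A\in\mathbb{R}^{n\times n}$, $B\in\mathbb{R}^{n\times m}$, $x_0\in\mathbb{R}^n$, $N\ge 1$, and let $\mathcal{D}_N=\{(x_k^+,x_k,u_k)\mid k=0,\dots,N-1\}$ be an online data set, i.e. $u_k\in\mathbb{R}^m$, $x_k^+=Ax_k+Bu_k$ for all $k=0,\dots,N-1$, and $x_k=x_{k-1}^+$ for $k=1,\dots,N-1$. For $u_N\in\mathbb{R}^m$ let $\mathcal{D}_{N+1}:=\mathcal{D}_N\cup\{(Ax_{N-1}^++Bu_N,\;x_{N-1}^+,\;u_N)\}$. Then the following two statements hold. 1) If $u_N\in\mathbb{R}^m$ satisfies $$\begin{pmatrix}u_N \\ x_{N-1}^+\end{pmatrix}\notin\operatorname{span}\left\{\begin{pmatrix}u_0 \\ x_0\end{pmatrix},\dots,\begin{pmatrix}u_{N-1} \\ x_{N-1}\end{pmatrix}\right\},$$ then the strict inclusion $\mathcal{H}(\mathcal{D}_{N+1})\subsetneq\mathcal{H}(\mathcal{D}_N)$ holds. 2) One has $$\begin{pmatrix}\tilde u \\ x_{N-1}^+\end{pmatrix}\in\operatorname{span}\left\{\begin{pmatrix}u_0 \\ x_0\end{pmatrix},\dots,\begin{pmatrix}u_{N-1} \\ x_{N-1}\end{pmatrix}\right\}\quad\text{for all }\tilde u\in\mathbb{R}^m$$ if and only if $\mathcal{H}(\mathcal{D}_N)=\mathcal{H}^*(x_0)$.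
   Context: System: $x_{k+1}=Ax_k+Bu_k$, discrete time, with state $x_k\in\mathbb{R}^n$, input $u_k\in\mathbb{R}^m$; $b^{(1)},\dots,b^{(m)}$ are the columns of $B$. Set of data consistent parameters. For a finite data set $\mathcal{D}$ of triples $(x^+,x,u)\in\mathbb{R}^n\times\mathbb{R}^n\times\mathbb{R}^m$, $\mathcal{H}(\mathcal{D})$ is the set of all $(\hat A,\hat B)\in\mathbb{R}^{n\times n}\times\mathbb{R}^{n\times m}$ with $x^+=\hat Ax+\hat Bu$ for every $(x^+,x,u)\in\mathcal{D}$. Explorable subspace. $\mathcal{V}_{\mathrm{exp}}(x_0)$ is the smallest $A$-invariant subspace of $\mathbb{R}^n$ containing $\{x_0,b^{(1)},\dots,b^{(m)}\}$, i.e. the intersection of all subspaces $\mathcal{V}\subseteq\mathbb{R}^n$ with $A\mathcal{V}\subseteq\mathcal{V}$ and $\{x_0,b^{(1)},\dots,b^{(m)}\}\subseteq\mathcal{V}$. Optimal identifiable set. $\mathcal{H}^*(x_0):=\{(\hat A,\hat B)\in\mathbb{R}^{n\times n}\times\mathbb{R}^{n\times m}\mid \hat Ax+\hat Bu=Ax+Bu\ \text{for all }(x,u)\in\mathcal{V}_{\mathrm{exp}}(x_0)\times\mathbb{R}^m\}$. *)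

(* Defs.v *)
From mathcomp Require Import all_boot all_order all_algebra.
From mathcomp Require Import all_classical reals.

Set Implicit Arguments.
Unset Strict Implicit.
Unset Printing Implicit Defensive.

Import GRing.Theory.
Local Open Scope classical_set_scope.
Local Open Scope ring_scope.

Definition consistent (R : realType) (n m : nat)
    (D : set ('cV[R]_n * 'cV[R]_n * 'cV[R]_m)) : set ('M[R]_n * 'M[R]_(n, m)) :=
  [set AB | forall xp x u, D (xp, x, u) -> xp = AB.1 *m x + AB.2 *m u].

Definition invariant_containing (R : realType) (n m : nat)
    (A : 'M[R]_n) (B : 'M[R]_(n, m)) (x0 : 'cV[R]_n) :
    set {vspace 'cV[R]_n} :=
  [set V | [/\ forall v, v \in V -> A *m v \in V,
               x0 \in V &
               forall j : 'I_m, col j B \in V]].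

Definition explorable (R : realType) (n m : nat)
    (A : 'M[R]_n) (B : 'M[R]_(n, m)) (x0 : 'cV[R]_n) : set 'cV[R]_n :=
  \bigcap_(V in invariant_containing A B x0) [set` V].

Definition optimal (R : realType) (n m : nat)
    (A : 'M[R]_n) (B : 'M[R]_(n, m)) (x0 : 'cV[R]_n) :
    set ('M[R]_n * 'M[R]_(n, m)) :=
  [set AB | forall x u, explorable A B x0 x ->
              AB.1 *m x + AB.2 *m u = A *m x + B *m u].

(* Trajectories are functions on nat of which only the values at k < N are
   constrained and used; [xp k] is the successor state $x_k^+$. *)
Definition online (R : realType) (n m : nat)
    (A : 'M[R]_n) (B : 'M[R]_(n, m)) (N : nat)
    (xp x : nat -> 'cV[R]_n) (u : nat -> 'cV[R]_m) : Prop :=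
  (forall k, (k < N)%N -> xp k = A *m x k + B *m u k) /\
  (forall k, (0 < k < N)%N -> x k = xp k.-1).

Definition dataset (R : realType) (n m N : nat)
    (xp x : nat -> 'cV[R]_n) (u : nat -> 'cV[R]_m) :
    set ('cV[R]_n * 'cV[R]_n * 'cV[R]_m) :=
  [set (xp k, x k, u k) | k in [set k | (k < N)%N]].

Definition data_span (R : realType) (n m N : nat)
    (x : nat -> 'cV[R]_n) (u : nat -> 'cV[R]_m) : {vspace 'cV[R]_(m + n)} :=
  <<[seq col_mx (u k) (x k) | k <- iota 0 N]>>%VS.

(* Main.v *)
Require Import Defs.
From mathcomp Require Import all_boot all_order all_algebra.
From mathcomp Require Import all_classical reals.
Import GRing.Theory.
Local Open Scope classical_set_scope.
Local Open Scope ring_scope.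

Set Implicit Arguments.
Unset Strict Implicit.

(** Stack an input and a state into one vector [(u, x)], and let [S] be the
    span of the stacked data.  A pair [(Ah, Bh)] explains the data exactly when
    the linear map [(u, x) |-> Ah x + Bh u] agrees with
    [(u, x) |-> A x + B u] on all of [S] ([consistentP]).  Two observations
    then give the theorem.

    A vector [z] outside [S] is detected by some pair explaining the data: a
    linear map killing [S] but not [z] can be added to [(A, B)]
    ([consistent_separates]).  Hence a new data point outside [S] rules out a
    pair that was consistent before.  It also shows that consistency with the
    data is strictly weaker than agreement with [(A, B)] on the explorable
    subspace as soon as [(ut, xp N.-1)] is outside [S] for one input [ut],
    because all states reached from [x 0] are explorable.

    Conversely, suppose that [(ut, xp N.-1)] lies in [S] for every [ut].
    Differences of such vectors give [(v, 0)] in [S] for every [v], so [S] is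
    the product of the input space with the state space [W] of all [w] such
    that [(0, w)] is in [S].  The dynamics sends [(u_k, x_k)] to the next state,
    which is in [W] again (for the last one this is the hypothesis), so it maps
    all of [S] into [W].  Thus [W] is invariant under [A] and contains the
    columns of [B], and it contains the explorable subspace
    ([explorable_sub_span]); agreement on [S] is then agreement on explorable
    states and arbitrary inputs. *)

(** The map is the projection along [U] onto a complement, composed with a
    matrix unit that moves a nonzero coordinate of the image of [z] to a row of
    the target; this is where the target must be nonzero. *)
Lemma separating_matrix (F : fieldType) (n p : nat) (n_gt0 : (0 < n)%N)
    (U : {vspace 'cV[F]_p}) (z : 'cV[F]_p) :
  z \notin U ->
  exists2 E : 'M[F]_(n, p),
    (forall s, s \in U -> E *m s = 0) & E *m z != 0.
Proof.
move=> zU.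
pose f : 'End('cV[F]_p) := (\1 - projv U)%VF.
pose M : 'M[F]_p := (lin1_mx (trmx \o f \o trmx))^T.
have ME v : M *m v = v - projv U v.
  apply: trmx_inj; rewrite trmx_mul trmxK mul_rV_lin1 /= trmxK.
  by rewrite add_lfunE opp_lfunE id_lfunE.
have /cV0Pn[i Mzi] : M *m z != 0.
  by rewrite ME subr_eq0; apply: contraNneq zU => ->; exact: memv_proj.
exists (delta_mx (Ordinal n_gt0) i *m M) => [s sU|].
  by rewrite -mulmxA ME projv_id // subrr mulmx0.
apply/cV0Pn; exists (Ordinal n_gt0).
rewrite -mulmxA mxE (bigD1 i) //= big1 => [|j ji]; rewrite mxE eqxx.
  by rewrite eqxx mul1r addr0.
by rewrite (negPf ji) mul0r.
Qed.

Section OnlineData.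

Variables (R : realType) (n m : nat) (A : 'M[R]_n) (B : 'M[R]_(n, m)).
Variables (N : nat) (xp x : nat -> 'cV[R]_n) (u : nat -> 'cV[R]_m).
Hypothesis x_online : online A B N xp x u.

Lemma mem_data_span k :
  (k < N)%N -> col_mx (u k) (x k) \in data_span N x u.
Proof.
move=> kN; apply/memv_span/mapP; exists k => //.
by rewrite mem_iota add0n.
Qed.

Lemma data_span_map (p : nat) (E : 'M[R]_(p, m + n))
    (V : {vspace 'cV[R]_p}) :
  (forall k, (k < N)%N -> E *m col_mx (u k) (x k) \in V) ->
  forall z, z \in data_span N x u -> E *m z \in V.
Proof.
move=> EV z zS; pose f : 'Hom('cV[R]_(m + n), 'cV[R]_p) := linfun (mulmx E).
have : f z \in (f @: data_span N x u)%VS by exact: memv_img.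
rewrite lfunE /= limg_span; apply: subvP; apply/span_subvP => w.
case/mapP=> s /mapP[k]; rewrite mem_iota add0n => kN -> ->.
by rewrite lfunE; exact: EV.
Qed.

(** Consistency only depends on the span of the stacked data: both sides of
    the consistency equation are linear in the stacked vector. *)
Lemma consistentP (Ah : 'M[R]_n) (Bh : 'M[R]_(n, m)) :
  consistent (dataset N xp x u) (Ah, Bh) <->
  (forall z, z \in data_span N x u -> row_mx Bh Ah *m z = row_mx B A *m z).
Proof.
have [xpE _] := x_online; split=> [cAB z zS|agree _ _ _ [k /= kN [<- <- <-]]].
  apply/eqP; rewrite -subr_eq0 -mulmxBl -memv0.
  apply: data_span_map zS => k kN.
  rewrite memv0 mulmxBl !mul_row_col subr_eq0 addrC.
  rewrite -(cAB (xp k) (x k) (u k)); first by rewrite xpE // addrC.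
  by exists k.
have := agree _ (mem_data_span kN).
by rewrite !mul_row_col addrC => ->; rewrite addrC -xpE.
Qed.

(** Adding to [(A, B)] a matrix that kills the data span but not the new
    stacked vector changes no prediction on the data. *)
Lemma consistent_separates (n_gt0 : (0 < n)%N) (ut : 'cV[R]_m)
    (y : 'cV[R]_n) :
  col_mx ut y \notin data_span N x u ->
  exists2 AB, consistent (dataset N xp x u) AB &
    AB.1 *m y + AB.2 *m ut <> A *m y + B *m ut.
Proof.
case/(separating_matrix n_gt0) => E ES Ez.
exists (A + rsubmx E, B + lsubmx E) => /=.
  apply/consistentP => z zS.
  by rewrite -add_row_mx hsubmxK addrC mulmxDl ES // add0r.
rewrite !mulmxDl addrACA => /(canRL (addKr _)); rewrite addNr => /eqP.
by rewrite addrC -mul_row_col hsubmxK (negPf Ez).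
Qed.

Lemma explorable_step (y : 'cV[R]_n) (v : 'cV[R]_m) :
  explorable A B (x 0%N) y -> explorable A B (x 0%N) (A *m y + B *m v).
Proof.
move=> yexp V VP; have yV := yexp V VP; case: VP => AV _ BV.
rewrite /= memvD ?AV //.
have -> : B *m v = \sum_j v j 0 *: col j B.
  apply/colP => i; rewrite mxE summxE; apply: eq_bigr => j _.
  by rewrite !mxE mulrC.
by apply: memv_suml => j _; exact: memvZ.
Qed.

Lemma explorable_x k : (k < N)%N -> explorable A B (x 0%N) (x k).
Proof.
have [xpE xE] := x_online; elim: k => [_ V [] //|k IHk kN].
rewrite (xE k.+1) //= xpE; last exact: ltnW.
exact/explorable_step/IHk/ltnW.
Qed.

Lemma explorable_xp k : (k < N)%N -> explorable A B (x 0%N) (xp k).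
Proof.
move=> kN; have [xpE _] := x_online; rewrite xpE //.
exact/explorable_step/explorable_x.
Qed.

Lemma optimal_sub_consistent :
  optimal A B (x 0%N) `<=` consistent (dataset N xp x u).
Proof.
have [xpE _] := x_online => AB optAB _ _ _ [k /= kN [<- <- <-]].
by rewrite optAB ?xpE //; exact: explorable_x.
Qed.

(** The saturation hypothesis makes the states [w] with [(0, w)] in the data
    span an invariant subspace containing [x 0] and the columns of [B]. *)
Lemma explorable_sub_span (N_gt0 : (0 < N)%N) :
  (forall ut : 'cV[R]_m, col_mx ut (xp N.-1) \in data_span N x u) ->
  forall (v : 'cV[R]_m) y, explorable A B (x 0%N) y ->
    col_mx v y \in data_span N x u.
Proof.
move=> sat; have [xpE xE] := x_online.
have inputS v : col_mx v 0 \in data_span N x u.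
  rewrite -[v]subr0 -(subrr (xp N.-1)) -add_col_mx -opp_col_mx.
  exact: memvB.
have stateS v y : col_mx v y \in data_span N x u ->
    col_mx 0 y \in data_span N x u.
  move=> vyS; rewrite -(subrr v) -[y]subr0 -add_col_mx -opp_col_mx.
  exact: memvB.
have nextS v y : col_mx v y \in data_span N x u ->
    col_mx 0 (A *m y + B *m v) \in data_span N x u.
  have -> : col_mx 0 (A *m y + B *m v)
          = col_mx (0 : 'M[R]_(m, m + n)) (row_mx B A) *m col_mx v y.
    by rewrite mul_col_mx mul0mx mul_row_col addrC.
  apply: data_span_map => k kN.
  rewrite mul_col_mx mul0mx mul_row_col addrC -xpE //.
  (* The successor is a later data state, except at the last step. *)
  have [kN1|] := ltnP k.+1 N.
    by apply: (stateS (u k.+1)); rewrite -[xp k](xE k.+1) // mem_data_span.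
  move=> Nk; have -> : k = N.-1 by apply/eqP; rewrite -eqSS prednK // eqn_leq kN.
  exact: sat.
pose g : 'Hom('cV[R]_n, 'cV[R]_(m + n)) := linfun (mulmx (col_mx 0 1%:M)).
pose W := (g @^-1: data_span N x u)%VS.
have memW w : (w \in W) = (col_mx 0 w \in data_span N x u).
  by rewrite -memv_preim lfunE /= mul_col_mx mul0mx mul1mx.
have WP : invariant_containing A B (x 0%N) W.
  split=> [w||j]; rewrite !memW.
  - by move/nextS; rewrite mulmx0 addr0.
  - exact/stateS/mem_data_span.
  - by have := nextS _ _ (inputS (delta_mx j 0)); rewrite mulmx0 add0r -colE.
move=> v y /(_ W WP) /=; rewrite memW => yS.
rewrite -[v]addr0 -[y]add0r -add_col_mx.
exact: memvD.
Qed.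

End OnlineData.

Unset Implicit Arguments.
Set Strict Implicit.

Theorem theorem4 (R : realType) (n m : nat) (n_gt0 : (0 < n)%N)
    (A : 'M[R]_n) (B : 'M[R]_(n, m)) (N : nat) (N_gt0 : (0 < N)%N)
    (xp x : nat -> 'cV[R]_n) (u : nat -> 'cV[R]_m)
    (x_online : online A B N xp x u) :
  (forall uN : 'cV[R]_m,
     col_mx uN (xp N.-1) \notin data_span N x u ->
     consistent (dataset N xp x u `|`
                 [set (A *m xp N.-1 + B *m uN, xp N.-1, uN)])
       `<` consistent (dataset N xp x u)) /\
  ((forall ut : 'cV[R]_m, col_mx ut (xp N.-1) \in data_span N x u) <->
   consistent (dataset N xp x u) = optimal A B (x 0%N)).
Proof.
split=> [uN zS|]; last split=> [sat|eqH ut].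
- split=> [AB cAB a b c abc|sub]; first by apply: cAB; left.
  have [AB cAB []] := consistent_separates x_online n_gt0 zS.
  by rewrite -(sub _ cAB (A *m xp N.-1 + B *m uN) (xp N.-1) uN) //; right.
- rewrite eqEsubset; split; last exact: optimal_sub_consistent.
  move=> [Ah Bh] /(consistentP x_online) agree y v yexp /=.
  have := agree _ (explorable_sub_span x_online N_gt0 sat v yexp).
  by rewrite !mul_row_col addrC => ->; rewrite addrC.
- apply/negPn/negP => zS.
  have [AB] := consistent_separates x_online n_gt0 zS.
  rewrite eqH => optAB []; apply: optAB.
  by apply: (explorable_xp x_online); rewrite prednK.
Qed.
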